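(* Fix $\beta\ge1$ and take any integers $1\le\ell\le m\le n$. Consider two coupled Dyson Brownian motions $$d\lambda_i(t)=\frac1n\sum_{j\ne i}\frac{dt}{\lambda_i(t)-\lambda_j(t)}+\Big(\frac{2}{\beta n}\Big)^{1/2}dB_i(t),\qquad d\widetilde\lambda_i(t)=\frac1n\sum_{j\ne i}\frac{dt}{\widetilde\lambda_i(t)-\widetilde\lambda_j(t)}+\Big(\frac{2}{\beta n}\Big)^{1/2}dB_i(t),$$ which share the same independent standard Brownian motions $\{B_i(t)\}_{1\le i\le n}$ (some particles are allowed to be at $\pm\infty$). 1. Assume that $\lambda_i(t)=+\infty$ for $i\in\{1,\dots,\ell-1\}$ and $\lambda_i(t)\in\mathbb R$ for $i\in\{\ell,\dots,n\}$, and that $\widetilde\lambda_i(t)\in\mathbb R$ for $i\in\{1,\dots,m\}$ and $\widetilde\lambda_i(t)=-\infty$ for $i\in\{m+1,\dots,n\}$. If $\lambda_i(0)\ge\widetilde\lambda_i(0)$ for all $\ell\le i\le m$, then $\lambda_i(t)\ge\widetilde\lambda_i(t)$ for all $\ell\le i\le m$ and $t\ge0$. 2. Assume that $\lambda_i(t)=+\infty$ for $i\in\{1,\dots,\ell-1\}$, $\lambda_i(t)=-\infty$ for $i\in\{m+1,\dots,n\}$, $\lambda_i(t)\in\mathbb R$ for $i\in\{\ell,\dots,m\}$, and $\widetilde\lambda_i(t)\in\mathbb R$ for $i\in\{1,\dots,n\}$. If $\lambda_i(0)-\lambda_j(0)\ge\widetilde\lambda_i(0)-\widetilde\lambda_j(0)$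 for all $\ell\le i<j\le m$, then $\lambda_i(t)-\lambda_j(t)\ge\widetilde\lambda_i(t)-\widetilde\lambda_j(t)$ for all $\ell\le i<j\le m$ and $t\ge0$.
   Context: Particles are ordered: $\lambda_1(t)\ge\cdots\ge\lambda_n(t)$ and likewise for $\widetilde\lambda$; solutions are continuous with the finite particles in the closure of the Weyl chamber. Particles at $\pm\infty$ stay there for all time, and any drift term $\frac{1}{\lambda_i-\lambda_j}$ with $\lambda_i$ finite and $\lambda_j=\pm\infty$ equals $0$; so if only the particles with indices in $\{a,\dots,b\}$ are finite, the equations are those of a Dyson Brownian motion of $b-a+1$ particles, still with the normalizations $\frac1n$ and $(\frac{2}{\beta n})^{1/2}$. The statements hold almost surely. *)

(* Defs.v *)
From HB Require Import structures.
From mathcomp Require Import all_boot all_order all_algebra.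
From mathcomp Require Import all_classical all_reals all_analysis.
From mathcomp Require Import measurable_realfun.

Set Implicit Arguments.
Unset Strict Implicit.
Unset Printing Implicit Defensive.

Import Order.TTheory GRing.Theory Num.Theory.
Import numFieldNormedType.Exports.

Local Open Scope classical_set_scope.
Local Open Scope ring_scope.

(* Time ranges over the nonnegative elements of a realType
   R; the values of filtrations and processes at negative times are
   irrelevant. *)

Definition is_filtration (R : realType) (d : measure_display)
    (T : measurableType d) (F : R -> set (set T)) : Prop :=
  [/\ forall t, 0 <= t -> sigma_algebra [set: T] (F t),
      forall t, 0 <= t -> F t `<=` measurable &
      forall s t, 0 <= s -> s <= t -> F s `<=` F t].

Definition adapted (R : realType) (d d' : measure_display)
    (T : measurableType d) (T' : measurableType d')
    (F : R -> set (set T)) (X : R -> T -> T') : Prop :=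
  forall t, 0 <= t -> forall U, measurable U -> F t (X t @^-1` U).

(* B_1, ..., B_n are independent standard Brownian motions relative to F: the
   product formula says that, for s < t, the sigma-algebra F s and the n
   increments B_i(t) - B_i(s) are mutually independent and each increment has
   law N(0, t - s) (normal_prob takes the standard deviation). Subfamilies are
   obtained by taking A or some of the U i to be the full set. *)
Definition is_brownian_family (R : realType) (d : measure_display)
    (T : measurableType d) (P : probability T R) (F : R -> set (set T))
    (n : nat) (B : 'I_n -> R -> T -> R) : Prop :=
  [/\ forall i, adapted F (B i),
      {ae P, forall w, forall i, B i 0 w = 0},
      {ae P, forall w, forall i,
         {within `[0, +oo[, continuous (fun t => B i t w)}} &
      forall (s t : R) (A : set T) (U : 'I_n -> set R),
        0 <= s -> s < t -> F s A -> (forall i, measurable (U i)) ->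
        P (A `&` [set w | forall i, U i (B i t w - B i s w)]) =
        (P A * \prod_(i < n) normal_prob 0 (Num.sqrt (t - s)) (U i))%E].

(* 1 / (x - y), read as 0 when x or y is infinite. When x = y is finite the
   value is +oo (the convention of inve) and not the total division of R,
   which would give 0: an integrable drift then forces the particles to be
   distinct at almost every time. *)
Definition repulsion (R : realType) (x y : \bar R) : \bar R :=
  if (x \is a fin_num) && (y \is a fin_num) then ((x - y)^-1)%E else 0%E.

Definition dyson_drift (R : realType) (n : nat) (x : 'I_n -> \bar R)
    (i : 'I_n) : \bar R :=
  ((n%:R^-1)%:E * \sum_(j < n | j != i) repulsion (x i) (x j))%E.

(* The path x solves the Dyson equation driven by the path b. As the noise is
   additive, the stochastic differential equation is the integral equation
   x_i(t) = x_i(0) + int_0^t drift ds + (2 / (beta n))^(1/2) b_i(t), required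
   for the finite particles. The ordering of all the particles in \bar R is the
   closed Weyl chamber for the finite ones. *)
Definition dyson_path (R : realType) (n : nat) (beta : R)
    (b : 'I_n -> R -> R) (x : 'I_n -> R -> \bar R) : Prop :=
  [/\ forall (i j : 'I_n) (t : R), 0 <= t -> (i <= j)%N -> (x j t <= x i t)%E,
      forall i, {within `[0, +oo[, continuous (x i)},
      forall i (t : R), 0 <= t -> x i 0 \isn't a fin_num -> x i t = x i 0 &
      forall i, x i 0 \is a fin_num -> forall t : R, 0 <= t ->
        [/\ x i t \is a fin_num,
            lebesgue_measure.-integrable `[0, t]
              (fun s => dyson_drift (x ^~ s) i) &
            x i t = (x i 0%R +
              \int[lebesgue_measure]_(s in `[0%R, t])
                 dyson_drift (x ^~ s) i +
              (Num.sqrt (2 / (beta * n%:R)) * b i t)%:E)%E]].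

Definition is_dyson_bm (R : realType) (d : measure_display)
    (T : measurableType d) (P : probability T R) (F : R -> set (set T))
    (n : nat) (beta : R) (B : 'I_n -> R -> T -> R)
    (lambda : 'I_n -> R -> T -> \bar R) : Prop :=
  (forall i, adapted F (lambda i)) /\
  {ae P, forall w, dyson_path beta (fun i t => B i t w)
                                   (fun i t => lambda i t w)}.

(* The ordinal i : 'I_n is the particle of index i.+1 in {1, ..., n}. *)
Definition finite_exactly_on (R : realType) (d : measure_display)
    (T : measurableType d) (P : probability T R) (n : nat)
    (lambda : 'I_n -> R -> T -> \bar R) (a b : nat) : Prop :=
  {ae P, forall w, forall (i : 'I_n) (t : R), 0 <= t ->
     [/\ (i.+1 < a)%N -> lambda i t w = +oo%E,
         (a <= i.+1 <= b)%N -> lambda i t w \is a fin_num &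
         (b < i.+1)%N -> lambda i t w = -oo%E]}.

(* Main.v *)
Require Import Defs.
From HB Require Import structures.
From mathcomp Require Import all_boot all_order all_algebra.
From mathcomp Require Import all_classical all_reals all_analysis.
From mathcomp Require Import measurable_realfun.
From mathcomp Require Import ring lra zify.
Import Order.TTheory GRing.Theory Num.Theory.
Import numFieldNormedType.Exports.
Local Open Scope classical_set_scope.
Local Open Scope ring_scope.

(** Both claims hold path by path. The two systems are driven by the same
    noise, so in the difference D_i of the two i-th particles the noise cancels
    and D_i is an integral of the difference of the two drifts.

    The comparison principle behind both parts is [nonneg_preserved]: if
    finitely many absolutely continuous functions D_i start nonnegative, and at
    almost every time the sum of D_i' over the indices with D_i < 0 is
    nonnegative, then all D_i stay nonnegative. Indeed the total negative part
    sum_i max(-D_i, 0) then has derivative -sum_(D_i < 0) D_i' <= 0. This L^1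
    form asks only for integrable drifts, not for integrability of their
    Lipschitz constants, which are of order 1/gap^2 and may fail to be
    integrable.

    At almost every time the drifts are finite, so the finite particles are
    strictly ordered, and the sign condition becomes an inequality between two
    strictly decreasing configurations.

    Part 1 ([force_deficit_ge0]), with D_i = x_i - y_i. Over the set N of
    indices where x_i < y_i, the interactions inside N cancel by antisymmetry.
    A particle j of both systems outside N satisfies x_j >= y_j, so it pushes
    x_i (i in N) up more than y_i; particles present in only one of the two
    systems push in the favourable direction.

    Part 2 ([gapforce_deficit_ge0]), with D_i the difference of the i-th gaps.
    The drift of a gap is nondecreasing in every other gap ([gapforce_le]),
    while the sum of the drifts of all gaps, which is the drift of the distance
    between the extreme particles, is nonincreasing in every gap
    ([sum_gapforce_le]). Let z be the configuration whose gaps are the minima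
    of those of x and y, and N the set of gaps that are smaller in x than in y.
    Passing from x to z changes only gaps outside N, which decreases the drifts
    of the gaps in N. Passing from y to z changes only the gaps in N and
    increases the total drift, but decreases the drifts of the gaps outside N,
    so that it increases the sum over N. The particles of y beyond the common
    range only shrink the gaps of y. *)

(** * The negative part of an absolutely continuous function *)

Section negative_part.
Context {R : realType}.
Notation mu := (@lebesgue_measure R).

(** A Lipschitz approximation, as c grows, of the indicator of x < 0. *)
Definition ramp (c x : R) : R := Num.min 1 (c * Num.max (- x) 0).

(** The convex function vanishing on x >= 0 with derivative [- ramp c], written
    in the form of a Legendre transform; it approximates the negative part. *)
Definition ramp_primitive (c x : R) : R :=
  ramp c x * Num.max (- x) 0 - ramp c x ^+ 2 / (2 * c).

Lemma ramp_itv (c x : R) : 0 < c -> 0 <= ramp c x <= 1.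
Proof.
move=> c0; rewrite /ramp ge_min lexx /= le_min ler01 /= andbT.
by rewrite mulr_ge0 ?(ltW c0)// le_max lexx orbT.
Qed.

(** Every r in [0, 1] gives a minorant of the Legendre transform; the ramp is
    where the supremum is reached. *)
Lemma ramp_primitive_sup (c x r : R) : 0 < c -> 0 <= r <= 1 ->
  r * Num.max (- x) 0 - r ^+ 2 / (2 * c) <= ramp_primitive c x.
Proof.
move=> c0 /andP[r0 r1]; rewrite /ramp_primitive /ramp.
have : 0 <= Num.max (- x) 0 by rewrite le_max lexx orbT.
set u := Num.max _ _ => u0.
(* Completing the square: the ramp is the point of [0, 1] closest to c * u. *)
have sq y : y * u - y ^+ 2 / (2 * c) =
            c * u ^+ 2 / 2 - (c * u - y) ^+ 2 / (2 * c).
  by field; lra.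
rewrite !sq lerD2l lerN2 ler_pM2r ?invr_gt0; last by lra.
set z := c * u.
case: (leP 1 z) => z1; last by rewrite subrr expr0n sqr_ge0.
by rewrite ler_sqr ?nnegrE; lra.
Qed.

(** The subgradient inequality at the right endpoint b: it bounds an increment
    of the primitive by a value of the ramp at a single time. *)
Lemma ramp_primitive_convex (c a b : R) : 0 < c ->
  ramp_primitive c b - ramp_primitive c a <= - ramp c b * (b - a).
Proof.
move=> c0; have h01 := ramp_itv c b c0.
have := ramp_primitive_sup c a _ c0 h01; move/andP: h01 => [h0 h1].
rewrite {2}/ramp_primitive => hs.
suff : ramp c b * Num.max (- b) 0 - ramp c b * Num.max (- a) 0 <=
   - ramp c b * (b - a) by lra.
have [b0|b0] := leP (- b) 0.
  suff -> : ramp c b = 0 by lra.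
  by rewrite /ramp (max_idPr b0) mulr0 minElt ltr10.
have : - a <= Num.max (- a) 0 by rewrite le_max lexx.
by nra.
Qed.

Lemma ramp_lipschitz (c a b : R) : 0 < c ->
  `|ramp c a - ramp c b| <= c * `|a - b|.
Proof.
move=> c0; wlog ab : a b / a <= b => [H|].
  by have [/H//|/ltW/H] := leP a b; rewrite distrC (distrC b).
have [uab uB] : Num.max (- b) 0 <= Num.max (- a) 0 /\
    Num.max (- a) 0 - Num.max (- b) 0 <= b - a.
  by case: (leP (- a) 0); case: (leP (- b) 0); split; lra.
rewrite [`|a - b|]ler0_norm ?subr_le0// opprB /ramp.
have : c * Num.max (- b) 0 <= c * Num.max (- a) 0 by rewrite ler_pM2l.
have := uB; rewrite -(ler_pM2l c0) mulrBr.
set z := c * Num.max (- a) 0; set w := c * Num.max (- b) 0 => zw wz.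
by case: (leP 1 z); case: (leP 1 w) => ? ?; rewrite ger0_norm; lra.
Qed.

Lemma nonincreasing_of_local (F : R -> R) (T eta : R) :
  0 <= T -> 0 < eta ->
  (forall s t, 0 <= s -> s <= t -> t <= T -> t - s < eta -> F t <= F s) ->
  F T <= F 0.
Proof.
move=> T0 eta0 Floc.
pose N := (Num.truncn (T / eta)).+1.
have N0 : (0 : R) < N%:R by rewrite ltr0n.
have TN : T / N%:R < eta.
  rewrite ltr_pdivrMr// mulrC -ltr_pdivrMr//; exact: truncnS_gt.
have step0 : 0 <= T / N%:R by rewrite divr_ge0// ltW.
suff H k : (k <= N)%N -> F (k%:R * (T / N%:R)) <= F 0.
  by have := H N (leqnn _); rewrite mulrC divfK// gt_eqF.
elim: k => [|k IH] kN; first by rewrite mul0r.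
apply: le_trans (IH (ltnW kN)).
have E : k.+1%:R * (T / N%:R) - k%:R * (T / N%:R) = T / N%:R.
  by rewrite -mulrBl -natrB// subSnn mul1r.
apply: Floc; rewrite ?E//.
- by rewrite mulr_ge0.
- by rewrite ler_wpM2r// ler_nat.
- rewrite mulrA ler_pdivrMr// mulrC ler_wpM2l// ler_nat//.
Qed.

(** Absolute continuity of the integral, on short intervals. *)
Lemma integral_norm_small (g : R -> R) (T e : R) : 0 < e ->
  mu.-integrable `[0, T] (EFin \o g) ->
  exists2 eta, 0 < eta & forall s t, 0 <= s -> s <= t -> t <= T -> t - s < eta ->
    \int[mu]_(x in `]s, t]) `|g x| < e.
Proof.
move=> e0 ig.
have ig' : mu.-integrable setT (EFin \o g \_ `[0, T]).
  by rewrite -restrict_EFin; apply/integrable_restrict => //=; rewrite setTI.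
have [d [d0 H]] := integral_normr_continuous ig' e0.
exists d => // s t s0 st tT std.
have -> : \int[mu]_(x in `]s, t]) `|g x| = \int[mu]_(x in `]s, t]) `|(g \_ `[0, T]) x|.
  apply: eq_Rintegral => x; rewrite inE /= in_itv /= => /andP[sx xt].
  by rewrite patchE mem_set//= in_itv/= (le_trans s0 (ltW sx)) (le_trans xt).
apply: H => //=; rewrite lebesgue_measure_itv/=; case: ifPn => _; last by rewrite lte_fin.
by rewrite -EFinD lte_fin.
Qed.

Lemma increment_primitive (D g : R -> R) (T s t : R) :
  mu.-integrable `[0, T] (EFin \o g) ->
  (forall t, 0 <= t <= T -> D t = D 0 + \int[mu]_(x in `[0, t]) g x) ->
  0 <= s -> s <= t -> t <= T -> D t - D s = \int[mu]_(x in `]s, t]) g x.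
Proof.
move=> ig HD s0 st tT.
rewrite (HD t) ?(le_trans s0 st)// (HD s) ?s0 ?(le_trans st tT)//.
rewrite -(@Rintegral_itvB _ _ (BLeft 0) _ s) ?bnd_simp//; first by ring.
by apply: integrableS ig => //; apply: subset_itvl; rewrite bnd_simp.
Qed.

Lemma measurable_primitive (D g : R -> R) (T : R) : 0 <= T ->
  mu.-integrable `[0, T] (EFin \o g) ->
  (forall t, 0 <= t <= T -> D t = D 0 + \int[mu]_(x in `[0, t]) g x) ->
  measurable_fun `[0, T] D.
Proof.
move=> T0 ig HD.
apply: (@eq_measurable_fun _ _ _ _ _
    (fun t => D 0 + parameterized_integral mu 0 t g)).
  by move=> t; rewrite inE/= in_itv/= => /HD ->.
apply: measurable_funD => //.
apply: subspace_continuous_measurable_fun => //.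
exact: parameterized_integral_continuous.
Qed.

Lemma integrable_mul01 (f g : R -> R) (T : R) :
  measurable_fun `[0, T] f -> (forall x, 0 <= f x <= 1) ->
  mu.-integrable `[0, T] (EFin \o g) ->
  mu.-integrable `[0, T] (EFin \o (fun s => f s * g s)).
Proof.
move=> mf f01 ig.
rewrite (_ : _ \o _ = ((EFin \o f) \* (EFin \o g))%E); last first.
  by apply/funext => x/=; rewrite EFinM.
apply: integrableMr => //; exists 1; split=> // M M1 x _ /=.
have /andP[h0 h1] := f01 x.
by rewrite ger0_norm// (le_trans h1)// ltW.
Qed.

Lemma integrable_subr (f g : R -> R) (t : R) :
  mu.-integrable `[0, t] (EFin \o f) -> mu.-integrable `[0, t] (EFin \o g) ->
  mu.-integrable `[0, t] (EFin \o (fun s => f s - g s)).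
Proof.
move=> fi gi; rewrite (_ : _ \o _ = (EFin \o f) \- (EFin \o g))%E//.
exact: integrableB.
Qed.

(** One half of the chain rule for [ramp_primitive] along an absolutely
    continuous D, without differentiating D. On a short interval ]s, t],
    convexity bounds the increment of [ramp_primitive c (D _)] by
    - ramp c (D t) * (D t - D s), and replacing ramp c (D t) by ramp c (D r)
    under the integral sign costs at most e times the integral of |g|. Summing
    over a fine subdivision leaves an error of e times a constant. *)
Lemma ramp_primitive_chain (c : R) (D g : R -> R) (T : R) : 0 < c -> 0 <= T ->
  mu.-integrable `[0, T] (EFin \o g) ->
  (forall t, 0 <= t <= T -> D t = D 0 + \int[mu]_(x in `[0, t]) g x) ->
  measurable_fun `[0, T] D ->
  ramp_primitive c (D T) + \int[mu]_(s in `[0, T]) (ramp c (D s) * g s)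
    <= ramp_primitive c (D 0).
Proof.
move=> c0 T0 ig HD mD.
have irg : mu.-integrable `[0, T] (EFin \o (fun s => ramp c (D s) * g s)).
  apply: integrable_mul01 => // [|x]; last exact: ramp_itv.
  apply: measurable_minr => //; apply: measurable_funM => //.
  by apply: measurable_maxr => //; exact: measurableT_comp.
have sub s t : 0 <= s -> s <= t -> t <= T -> `]s, t] `<=` `[0, T].
  move=> s0 st tT; apply: subset_itvScc; rewrite ?bnd_simp//.
have ian : mu.-integrable `[0, T] (EFin \o (fun x => `|g x|)) by exact: integrable_norm.
pose V t := \int[mu]_(x in `[0, t]) `|g x|.
apply/ler_addgt0Pr => /= e e0.
(* The smaller e' absorbs the factor V T; the + 1 covers V T = 0. *)
have [e' e'0 e'V] : exists2 e', 0 < e' & e' * V T <= e.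
  have V0 : 0 <= V T by apply: Rintegral_ge0.
  exists (e / (V T + 1)); first by rewrite divr_gt0// ltr_wpDl.
  by rewrite mulrAC ler_pdivrMr ?ltr_wpDl// ler_wpM2l ?lerDl// ltW.
have [eta eta0 Heta] := integral_norm_small g T (e' / c) (divr_gt0 e'0 c0) ig.
pose W t := \int[mu]_(s in `[0, t]) (ramp c (D s) * g s).
pose F t := ramp_primitive c (D t) + W t - e' * V t.
suff : F T <= F 0.
  rewrite /F /W /V !set_itv1 !Rintegral_set1 mulr0 subr0 addr0 -/(V T); lra.
apply: (nonincreasing_of_local F T eta) => // s t s0 st tT ste.
have WB : W t - W s = \int[mu]_(s in `]s, t]) (ramp c (D s) * g s).
  apply: Rintegral_itvB; rewrite ?bnd_simp//.
  by apply: integrableS irg => //; apply: subset_itvl; rewrite bnd_simp.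
have VB : V t - V s = \int[mu]_(s in `]s, t]) `|g s|.
  apply: Rintegral_itvB; rewrite ?bnd_simp//.
  by apply: integrableS ian => //; apply: subset_itvl; rewrite bnd_simp.
have iS f : mu.-integrable `[0, T] (EFin \o f) ->
    mu.-integrable `]s, t] (EFin \o f).
  by apply: integrableS => //; exact: sub.
suff : W t - W s - ramp c (D t) * (D t - D s) <= e' * (V t - V s).
  have := ramp_primitive_convex c (D s) (D t) c0; rewrite /F; lra.
rewrite (increment_primitive D g T)// VB WB -!RintegralZl//; try exact: iS.
rewrite -RintegralB//; first last.
- rewrite (_ : _ \o _ = (fun x => (ramp c (D t))%:E * (EFin \o g) x)%E)//.
  by apply: integrableZl => //; exact: iS.
- exact: iS.
apply: le_Rintegral => //.
- rewrite (_ : _ \o _ = (EFin \o (fun x => (ramp c (D x) * g x)%R)) \-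
    (fun x => (ramp c (D t))%:E * (EFin \o g) x))%E//.
  apply: integrableB => //; first exact: iS.
  by apply: integrableZl => //; exact: iS.
- rewrite (_ : _ \o _ = (fun x => e'%:E * (EFin \o (fun x => `|g x|%R)) x)%E)//.
  by apply: integrableZl => //; exact: iS.
move=> x /=; rewrite in_itv/= => /andP[sx xt].
rewrite -mulrBl (le_trans (ler_norm _))// normrM ler_wpM2r//.
apply: (le_trans (ramp_lipschitz c (D x) (D t) c0)).
rewrite mulrC -ler_pdivlMr// distrC.
have x0 : 0 <= x by rewrite (le_trans s0)// ltW.
rewrite (increment_primitive D g T)//.
apply: (le_trans (le_normr_Rintegral _ _)) => //.
  by apply: integrableS ig => //; exact: sub.
apply/ltW/Heta => //.
by rewrite (le_lt_trans _ ste)// lerD2l lerN2 ltW.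
Qed.

Lemma ramp_cvg (x : R) : ramp k.+1%:R x @[k --> \oo] --> ((x < 0)%R%:R : R).
Proof.
apply: cvg_near_cst; rewrite /ramp; case: ltP => x0.
  near=> k; rewrite (max_idPl _) ?oppr_ge0 ?ltW//; apply/min_idPl.
  rewrite mulrC -ler_pdivrMl ?oppr_gt0// mulr1.
  apply: (@le_trans _ _ k%:R); last by rewrite ler_nat.
  by near: k; exact: nbhs_infty_ger.
by near=> k; rewrite (max_idPr _) ?oppr_le0// mulr0 minElt ltr10.
Unshelve. all: by end_near. Qed.

Lemma measurable_ltr0_indic (D : R -> R) (T : R) :
  measurable_fun `[0, T] D -> measurable_fun `[0, T] (fun s => (D s < 0)%R%:R : R).
Proof.
move=> mD.
rewrite (_ : (fun _ => _) = (fun s => if D s < 0 then 1 else 0)); last first.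
  by apply/funext => s; case: ltP.
apply: measurable_fun_if => //.
apply: (measurable_fun_bool true).
rewrite (_ : _ @^-1` _ = D @^-1` `]-oo, 0[); last first.
  by apply/seteqP; split => s /=; rewrite in_itv.
exact: mD.
Qed.

(** Letting c tend to infinity in [ramp_primitive_chain]: the ramp tends to the
    indicator of the strict inequality D < 0 and is bounded by 1, so dominated
    convergence applies although the Lipschitz constant c blows up. The zero set
    of D needs no separate treatment because the ramp vanishes there. *)
Lemma negative_part_le (D g : R -> R) (T : R) : 0 <= T ->
  mu.-integrable `[0, T] (EFin \o g) ->
  (forall t, 0 <= t <= T -> D t = D 0 + \int[mu]_(x in `[0, t]) g x) ->
  0 <= D 0 ->
  Num.max (- D T) 0 <= - \int[mu]_(s in `[0, T]) ((D s < 0)%R%:R * g s).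
Proof.
move=> T0 ig HD D0.
have mD := measurable_primitive D g T T0 ig HD.
have kpos (k : nat) : 0 < k.+1%:R :> R by rewrite ltr0n.
pose I k := \int[mu]_(s in `[0, T]) (ramp k.+1%:R (D s) * g s).
have ian : mu.-integrable `[0, T] (EFin \o (fun x => `|g x|)) by exact: integrable_norm.
have mr k : measurable_fun `[0, T] (fun s => ramp k.+1%:R (D s)).
  apply: measurable_minr => //; apply: measurable_funM => //.
  by apply: measurable_maxr => //; exact: measurableT_comp.
have bound k : Num.max (- D T) 0 - (2 * k.+1%:R)^-1 + I k <= 0.
  have := ramp_primitive_chain k.+1%:R D g T (kpos k) T0 ig HD mD.
  (* With r = 1 the minorant is the negative part up to an error 1 / (2 c). *)
  have := ramp_primitive_sup k.+1%:R (D T) 1 (kpos k).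
  rewrite ler01 lexx mul1r expr1n mul1r => /(_ isT).
  suff -> : ramp_primitive k.+1%:R (D 0) = 0.
    by rewrite -/(I k) => + chain; set q := (2 * _)^-1 => minorant; lra.
  rewrite /ramp_primitive /ramp (max_idPr _) ?oppr_le0//.
  by rewrite !mulr0 minElt ltr10 expr0n mul0r subr0.
have cI : I k @[k --> \oo] --> \int[mu]_(s in `[0, T]) ((D s < 0)%R%:R * g s).
  apply: fine_cvg; rewrite fineK; last first.
    apply: integrable_fin_num => //; apply: integrable_mul01 => //.
      exact: measurable_ltr0_indic.
    by move=> x; rewrite ler0n lern1 leq_b1.
  apply: (@dominated_cvg _ _ _ mu `[0, T] _
    (fun k x => (ramp k.+1%:R (D x) * g x)%:E) _ (EFin \o (fun x => `|g x|))) => //=.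
  - move=> k; apply/measurable_EFinP/measurable_funM; first exact: mr.
    by apply/measurable_EFinP; case/integrableP: ig.
  - move=> x _; apply: cvg_EFin; first exact: nearW.
    by apply: cvgMl; exact: ramp_cvg.
  - move=> k x _ /=; rewrite lee_fin normrM ler_piMl//.
    by have /andP[h0 h1] := ramp_itv _ (D x) (kpos k); rewrite ger0_norm.
rewrite -subr_le0 opprK.
suff cF : Num.max (- D T) 0 - (2 * k.+1%:R)^-1 + I k @[k --> \oo] -->
    Num.max (- D T) 0 + \int[mu]_(s in `[0, T]) ((D s < 0)%R%:R * g s).
  by apply: (cvgr_to_le cF); exact: nearW.
rewrite -[X in X + _]subr0; apply: cvgD => //; apply: cvgB; first exact: cvg_cst.
rewrite (_ : (fun _ => _) = (fun k : nat => 2^-1 * @harmonic R k)); last first.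
  by apply/funext => k; rewrite invfM.
by rewrite -[X in _ --> X](mulr0 2^-1); apply: cvgMr; exact: cvg_harmonic.
Unshelve. all: by end_near. Qed.

(** The total negative part of the family has a nonpositive derivative. Only the
    sum over the negative indices has to be controlled: each D i alone may have
    the wrong sign of derivative. *)
Lemma nonneg_preserved (J : finType) (Q : pred J) (D g : J -> R -> R) :
  (forall i, Q i -> 0 <= D i 0) ->
  (forall i t, Q i -> 0 <= t -> mu.-integrable `[0, t] (EFin \o g i)) ->
  (forall i t, Q i -> 0 <= t -> D i t = D i 0 + \int[mu]_(x in `[0, t]) g i x) ->
  (forall t, 0 <= t -> {ae mu, forall s, `[0, t]%classic s ->
     0 <= \sum_(i | Q i && (D i s < 0)) g i s}) ->
  forall i t, Q i -> 0 <= t -> 0 <= D i t.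
Proof.
move=> D0 ig HD Hae i T Qi T0.
have HD' j : Q j -> forall t, 0 <= t <= T ->
    D j t = D j 0 + \int[mu]_(x in `[0, t]) g j x.
  by move=> Qj t /andP[t0 _]; exact: HD.
(* Extending by 0 outside Q makes every h j integrable. *)
pose h j s := if Q j then (D j s < 0)%R%:R * g j s else 0.
have ih j : mu.-integrable `[0, T] (EFin \o h j).
  rewrite /h; case: (boolP (Q j)) => Qj; last exact: integrable0.
  apply: integrable_mul01; last exact: ig.
    apply: measurable_ltr0_indic.
    exact: (measurable_primitive (D j) (g j) T T0 (ig _ _ Qj T0) (HD' _ Qj)).
  by move=> x; rewrite ler0n lern1 leq_b1.
have isum : mu.-integrable `[0, T] (EFin \o (fun s => \sum_(j | Q j) h j s)).
  rewrite (_ : _ \o _ = (fun s => (\sum_(j | Q j) (EFin \o h j) s)%E)); last first.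
    by apply/funext => s /=; rewrite sumEFin.
  by apply: integrable_sum.
have E : (\int[mu]_(s in `[0%R, T]) (\sum_(j | Q j) h j s)%R%:E =
         \sum_(j | Q j) (\int[mu]_(s in `[0%R, T]) h j s)%R%:E)%E.
  under eq_integral do rewrite -sumEFin.
  rewrite integral_sum//.
  by apply: eq_bigr => j Qj; rewrite fineK//; apply: integrable_fin_num => //; exact: ih.
have I0 : 0 <= \sum_(j | Q j) \int[mu]_(s in `[0, T]) h j s.
  rewrite -lee_fin -sumEFin -E.
  have -> : (\int[mu]_(s in `[0%R, T]) (\sum_(j | Q j) h j s)%R%:E =
      \int[mu]_(s in `[0%R, T]) (Num.max (\sum_(j | Q j) h j s) 0)%R%:E)%E.
    apply: ae_eq_integral => //.
    - by case/integrableP: isum.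
    - apply/measurable_EFinP/measurable_maxr => //.
      by apply/measurable_EFinP; case/integrableP: isum.
    - apply: filterS (Hae _ T0); first exact: (ae_filter_ringOfSetsType mu).
      move=> s H sT; congr EFin; apply/esym/max_idPl.
      rewrite (le_trans (H sT))// le_eqVlt big_mkcondr/=; apply/orP; left.
      by apply/eqP/eq_bigr => j Qj; rewrite /h Qj; case: ifP; rewrite ?mul1r ?mul0r.
  by apply: integral_ge0 => s _; rewrite lee_fin le_max lexx orbT.
have : \sum_(j | Q j) Num.max (- D j T) 0 <= 0.
  apply: (@le_trans _ _ (\sum_(j | Q j) - \int[mu]_(s in `[0, T]) h j s)); last first.
    by rewrite sumrN oppr_le0.
  apply: ler_sum => j Qj; rewrite /h Qj.
  exact: (negative_part_le (D j) (g j) T T0 (ig _ _ Qj T0) (HD' _ Qj) (D0 _ Qj)).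
rewrite (bigD1 i)//= => H.
have H2 : 0 <= \sum_(j | Q j && (j != i)) Num.max (- D j T) 0.
  by apply: sumr_ge0 => j _; rewrite le_max lexx orbT.
have : - D i T <= Num.max (- D i T) 0 by rewrite le_max lexx.
lra.
Qed.

End negative_part.

(** * Interaction forces of ordered configurations *)

Section forces.
Context {R : realType}.

(** The self-interaction j = i is allowed, since it contributes 0^-1 = 0; this
    makes all the sums below range over the same indices and comparable term by
    term. *)
Definition force (n : nat) (P : pred nat) (x : nat -> R) (i : nat) : R :=
  \sum_(j < n | P j) (x i - x j)^-1.

Definition within (l m : nat) : pred nat := fun j => (l <= j < m)%N.

Definition gapforce (n l m : nat) (x : nat -> R) (i : nat) : R :=
  force n (within l m) x i - force n (within l m) x i.+1.

(** Newton's third law: the internal forces of a group add up to 0. *)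
Lemma antisymmetric_sum0 (J : finType) (Q : pred J) (t : J -> J -> R) :
  (forall i j, Q i -> Q j -> t i j = - t j i) ->
  \sum_(i | Q i) \sum_(j | Q j) t i j = 0.
Proof.
move=> tN; set S := LHS.
suff : S = - S by lra.
rewrite {1}/S exchange_big /= -sumrN; apply: eq_bigr => j Qj.
by rewrite -sumrN; apply: eq_bigr => i Qi; rewrite tN.
Qed.

(** The group N of the indices with x_i < y_i has no internal contribution. For
    i in N and j outside N, either j is in both systems, and then
    x_i - x_j < y_i - y_j with the same sign on both sides, so that x_i is
    pushed up more; or j >= m only repels x_i from below; or j < l only repels
    y_i from above. *)
Lemma force_deficit_ge0 n l m x y :
  (forall i j, (l <= i)%N -> (i < j < n)%N -> x j < x i) ->
  (forall i j, (i < j < m)%N -> y j < y i) ->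
  (m <= n)%N ->
  0 <= \sum_(i < n | (l <= i < m)%N && (x i - y i < 0))
        (force n (leq l) x i - force n (gtn m) y i).
Proof.
move=> hx hy mn.
pose N (i : 'I_n) := (l <= i < m)%N && (x i - y i < 0).
pose t (i j : 'I_n) := (if (l <= j)%N then (x i - x j)^-1 else 0) -
                       (if (j < m)%N then (y i - y j)^-1 else 0).
have -> : \sum_(i < n | N i) (force n (leq l) x i - force n (gtn m) y i) =
    \sum_(i < n | N i) \sum_(j | N j) t i j +
    \sum_(i < n | N i) \sum_(j | ~~ N j) t i j.
  rewrite -big_split/=; apply: eq_bigr => i _.
  transitivity (\sum_j t i j); last exact: (bigID N).
  by rewrite sumrB -!big_mkcond.
rewrite antisymmetric_sum0 ?add0r; last first.
  move=> i j /andP[/andP[li im] _] /andP[/andP[lj jm] _].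
  by rewrite /t li im lj jm -(opprB (x j)) -(opprB (y j)) !invrN; ring.
apply: sumr_ge0 => i /andP[/andP[li im]]; rewrite subr_lt0 => xyi.
apply: sumr_ge0 => j; rewrite /N/t negb_and subr_lt0 -leNgt.
case: (leqP l j) => lj; case: (ltnP j m) => jm //= yxj.
- rewrite subr_ge0.
  have [ij|ji|ij] := ltngtP i j.
  + have := hx i j li; have := hy i j; rewrite ij jm ltn_ord => /(_ isT) h1 /(_ isT) h2.
    by rewrite lef_pV2 ?posrE; lra.
  + have := hx j i lj; have := hy j i; rewrite ji im ltn_ord => /(_ isT) h1 /(_ isT) h2.
    by rewrite lef_nV2 ?negrE; lra.
  + by move: yxj; rewrite -(val_inj ij); lra.
- have := hx i j li; rewrite ltn_ord (leq_trans im jm) => /(_ isT) h.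
  by rewrite subr0 invr_ge0; lra.
- have := hy j i; rewrite im (leq_trans lj li) => /(_ isT) h.
  by rewrite sub0r oppr_ge0 invr_le0; lra.
Qed.

Lemma nonincreasing_on_range (l m : nat) (z : nat -> R) :
  (forall i, (l <= i)%N -> (i.+1 < m)%N -> z i.+1 <= z i) ->
  forall j k, (l <= j)%N -> (j <= k)%N -> (k < m)%N -> z k <= z j.
Proof.
move=> hz j k lj /subnKC <-; elim: (k - j)%N => [|d IH]; rewrite ?addn0// addnS => dm.
apply: le_trans (IH (ltnW dm)); apply: hz => //; lia.
Qed.

Lemma gap_le_on_range (l m : nat) (x y : nat -> R) :
  (forall k, (l <= k)%N -> (k.+1 < m)%N -> y k - y k.+1 <= x k - x k.+1) ->
  forall j k, (l <= j)%N -> (j <= k)%N -> (k < m)%N -> y j - y k <= x j - x k.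
Proof.
move=> h j k lj jk km; suff : x k - y k <= x j - y j by lra.
apply: (nonincreasing_on_range l m (fun k => x k - y k)) => // a la am.
by have := h a la am; lra.
Qed.

Lemma decreasing_on_range (l m : nat) (y : nat -> R) :
  (forall k, (l <= k)%N -> (k.+1 < m)%N -> 0 < y k - y k.+1) ->
  forall j k, (l <= j)%N -> (j < k)%N -> (k < m)%N -> y k < y j.
Proof.
move=> h j k lj jk km.
have : y k <= y j.+1.
  apply: (nonincreasing_on_range l m y) => //; last by lia.
  by move=> a la am; have := h a la am; lra.
by have := h j lj (leq_ltn_trans jk km); lra.
Qed.

(** Convexity of the inverse: a gap g is pushed together less by a particle that
    is farther away. *)
Lemma inverse_increment (g v w : R) : 0 < g -> 0 < v -> v <= w ->
  w^-1 - (w + g)^-1 <= v^-1 - (v + g)^-1.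
Proof.
move=> g0 v0 vw.
have E u : 0 < u -> u^-1 - (u + g)^-1 = g / (u * (u + g)).
  by move=> u0; field; rewrite !gt_eqF//; lra.
rewrite !E//; last by lra.
by rewrite ler_pM2l// lef_pV2 ?posrE; nra.
Qed.

(** The drift of a gap is nondecreasing in the other gaps: widening them moves
    the outer particles away, and the interaction within the gap itself depends
    only on its width, which is fixed. *)
Lemma gapforce_le n l m x y i :
  (forall k, (l <= k)%N -> (k.+1 < m)%N -> 0 < y k - y k.+1 <= x k - x k.+1) ->
  (l <= i)%N -> (i.+1 < m)%N -> x i - x i.+1 = y i - y i.+1 ->
  gapforce n l m y i <= gapforce n l m x i.
Proof.
move=> h li im xyi.
have xy : forall j k, (l <= j)%N -> (j <= k)%N -> (k < m)%N -> y j - y k <= x j - x k.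
  by apply: gap_le_on_range => k lk km; case/andP: (h k lk km).
have y0 : forall j k, (l <= j)%N -> (j < k)%N -> (k < m)%N -> y k < y j.
  by apply: decreasing_on_range => k lk km; case/andP: (h k lk km).
have /andP[yi _] := h i li im.
rewrite /gapforce /force -!sumrB; apply: ler_sum => j /andP[lj jm].
have [ji|ij|ij] := ltngtP j i.
- have h0 : 0 < y j - y i by rewrite subr_gt0; apply: y0 => //; exact: ltnW.
  have := inverse_increment _ _ _ yi h0 (xy j i lj (ltnW ji) (ltnW im)).
  rewrite (_ : y j - y i + (y i - y i.+1) = y j - y i.+1); last by ring.
  rewrite -{1}xyi (_ : x j - x i + (x i - x i.+1) = x j - x i.+1); last by ring.
  rewrite -(opprB (x j)) -(opprB (x j)) -(opprB (y j)) -(opprB (y j) (y i.+1)) !invrN; lra.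
- move: ij; rewrite leq_eqVlt => /predU1P[<-|ij].
    by rewrite !subrr !invr0 xyi.
  have h0 : 0 < y i.+1 - y j by rewrite subr_gt0; apply: y0 => //; exact: leqW.
  have := inverse_increment _ _ _ yi h0 (xy i.+1 j (leqW li) (ltnW ij) jm).
  rewrite (_ : y i.+1 - y j + (y i - y i.+1) = y i - y j); last by ring.
  rewrite -{1}xyi (_ : x i.+1 - x j + (x i - x i.+1) = x i - x j); last by ring.
  lra.
- by rewrite ij !subrr -(opprB (x i)) -(opprB (y i)) xyi.
Qed.

Lemma sum_gapforce n l m x : (l < m <= n)%N ->
  \sum_(i < n | (l <= i)%N && (i.+1 < m)%N) gapforce n l m x i =
  force n (within l m) x l - force n (within l m) x m.-1.
Proof.
move=> /andP[lm mn].
have E : \sum_(l <= i < m.-1) gapforce n l m x i =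
         \sum_(i < n | (l <= i)%N && (i.+1 < m)%N) gapforce n l m x i.
  rewrite -(big_mkord (fun i => (l <= i)%N && (i.+1 < m)%N) (fun i => gapforce n l m x i)).
  rewrite (big_nat_widenl l 0)// (@big_nat_widen _ _ _ 0 m.-1 n); last by lia.
  by apply: eq_bigl => i /=; rewrite ltn_predRL.
rewrite -E /gapforce; under eq_bigr do rewrite -opprB.
by rewrite sumrN telescope_sumr ?opprB//; lia.
Qed.

(** The sum of the gap drifts is the drift of x_l - x_(m-1). Every particle,
    lying between these two, pushes them apart, and less so at a larger
    distance. *)
Lemma sum_gapforce_le n l m x y : (l < m <= n)%N ->
  (forall k, (l <= k)%N -> (k.+1 < m)%N -> 0 < y k - y k.+1 <= x k - x k.+1) ->
  \sum_(i < n | (l <= i)%N && (i.+1 < m)%N) gapforce n l m x i <=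
  \sum_(i < n | (l <= i)%N && (i.+1 < m)%N) gapforce n l m y i.
Proof.
move=> lmn h; rewrite !sum_gapforce//; move: lmn => /andP[lm mn].
have xy : forall j k, (l <= j)%N -> (j <= k)%N -> (k < m)%N -> y j - y k <= x j - x k.
  by apply: gap_le_on_range => k lk km; case/andP: (h k lk km).
have y0 : forall j k, (l <= j)%N -> (j < k)%N -> (k < m)%N -> y k < y j.
  by apply: decreasing_on_range => k lk km; case/andP: (h k lk km).
have inv j k : (l <= j)%N -> (j <= k)%N -> (k < m)%N ->
    (x j - x k)^-1 <= (y j - y k)^-1.
  move=> lj; rewrite leq_eqVlt => /predU1P[<-|jk km]; first by rewrite !subrr.
  have h1 := xy j k lj (ltnW jk) km; have h2 := y0 j k lj jk km.
  by rewrite lef_pV2 ?posrE; lra.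
rewrite /force -!sumrB; apply: ler_sum => j /andP[lj jm].
have h1 := inv l j (leqnn l) lj jm.
have : (x j - x m.-1)^-1 <= (y j - y m.-1)^-1 by apply: inv => //; lia.
rewrite -(opprB (x j) (x m.-1)) -(opprB (y j) (y m.-1)) !invrN; lra.
Qed.

(** The configuration z with the smaller of the two gaps everywhere separates
    the two monotonicities: x and z have the same gaps on N, y and z have the
    same gaps off N. *)
Lemma gapforce_deficit_ge0 n l m x y :
  (forall i, (l <= i)%N -> (i.+1 < m)%N -> x i.+1 < x i) ->
  (forall i j, (i < j < n)%N -> y j < y i) ->
  (l < m <= n)%N ->
  0 <= \sum_(i < n | ((l <= i)%N && (i.+1 < m)%N) &&
                      ((x i - y i) - (x i.+1 - y i.+1) < 0))
        (gapforce n l m x i - (force n predT y i - force n predT y i.+1)).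
Proof.
move=> hx hy lmn; have /andP[lm mn] := lmn.
have y1 i : (l <= i)%N -> (i.+1 < m)%N -> y i.+1 < y i.
  by move=> _ im; apply: hy; rewrite ltnSn/= (leq_trans im).
pose G (i : 'I_n) := (l <= i)%N && (i.+1 < m)%N.
pose N (i : 'I_n) := (x i - y i) - (x i.+1 - y i.+1) < 0.
(* The last gap of the sum refers to position m, which only shifts z. *)
pose z i := \sum_(i <= k < m) Num.min (x k - x k.+1) (y k - y k.+1).
have zE i : (i < m)%N -> z i - z i.+1 = Num.min (x i - x i.+1) (y i - y i.+1).
  by move=> im; rewrite /z big_ltn// addrK.
have zx k : (l <= k)%N -> (k.+1 < m)%N -> 0 < z k - z k.+1 <= x k - x k.+1.
  move=> lk km; rewrite zE ?(ltnW km)// ge_min lexx lt_min !subr_gt0 hx//.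
  by rewrite y1.
have zy k : (l <= k)%N -> (k.+1 < m)%N -> 0 < z k - z k.+1 <= y k - y k.+1.
  move=> lk km; rewrite zE ?(ltnW km)// ge_min lexx orbT lt_min !subr_gt0 hx//.
  by rewrite y1.
(* A particle of y outside the common range pushes the nearer end of the gap
   inwards more strongly than the farther end outwards. *)
have outer i : G i -> force n predT y i - force n predT y i.+1 <= gapforce n l m y i.
  move=> /andP[li im].
  have split k : force n predT y k = force n (within l m) y k +
      \sum_(j < n | ~~ within l m j) (y k - y j)^-1.
    by rewrite /force (bigID (fun j : 'I_n => within l m j)).
  rewrite /gapforce !split.
  suff : \sum_(j < n | ~~ within l m j) (y i - y j)^-1 <=
         \sum_(j < n | ~~ within l m j) (y i.+1 - y j)^-1 by lra.
  have yi := y1 i li im.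
  apply: ler_sum => j; rewrite /within negb_and -ltnNge -leqNgt => /orP[jl|mj].
    have := hy j i; rewrite ltn_ord (leq_trans jl li) => /(_ isT) h.
    by rewrite lef_nV2 ?negrE; lra.
  have := hy i.+1 j; rewrite ltn_ord (leq_trans im mj) => /(_ isT) h.
  by rewrite lef_pV2 ?posrE; lra.
apply: (@le_trans _ _ (\sum_(i < n | G i && N i)
    (gapforce n l m x i - gapforce n l m y i))); last first.
  by apply: ler_sum => i /andP[Gi _]; have := outer i Gi; lra.
have H1 : \sum_(i < n | G i && N i) gapforce n l m z i <=
          \sum_(i < n | G i && N i) gapforce n l m x i.
  apply: ler_sum => i /andP[/andP[li im]]; rewrite /N => Ni.
  apply: gapforce_le => //; rewrite zE ?(ltnW im)//.
  by apply/esym/min_idPl; lra.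
have H2 : \sum_(i < n | G i && ~~ N i) gapforce n l m z i <=
          \sum_(i < n | G i && ~~ N i) gapforce n l m y i.
  apply: ler_sum => i /andP[/andP[li im]]; rewrite /N -leNgt => Ni.
  apply: gapforce_le => //; rewrite zE ?(ltnW im)//.
  by apply/esym/min_idPr; lra.
rewrite big_split/= sumrN.
have := sum_gapforce_le n l m y z lmn zy.
rewrite (bigID N) [X in _ <= X](bigID N)/=.
move: H1 H2; rewrite /G; lra.
Qed.

End forces.

(** * Sample paths of Dyson Brownian motion *)

Section dyson_paths.
Context {R : realType}.
Notation mu := (@lebesgue_measure R).

(** Positions and drifts are indexed by natural numbers, so that the neighbour
    i.+1 can be named; indices beyond the last particle give junk values. *)
Definition position {n} (x : 'I_n.+1 -> R -> \bar R) (k : nat) (t : R) : R :=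
  fine (x (inord k) t).

Definition drift {n} (x : 'I_n.+1 -> R -> \bar R) (k : nat) (s : R) : R :=
  fine (dyson_drift (x ^~ s) (inord k)).

Lemma repulsion_fin_num (x y : \bar R) : x \is a fin_num -> y \is a fin_num ->
  repulsion x y \is a fin_num ->
  fine x != fine y /\ repulsion x y = (fine x - fine y)^-1%:E.
Proof.
rewrite /repulsion; case: x => // x; case: y => // y _ _ /=.
by rewrite -EFinB inver subr_eq0; case: eqP.
Qed.

(** A repulsion is a real number or +oo, never -oo, so a finite drift leaves no
    room for a collision. *)
Lemma dyson_drift_fin_num n (P : pred nat) (z : 'I_n.+1 -> \bar R) (i : 'I_n.+1) :
  (forall j : 'I_n.+1, (z j \is a fin_num) = P j) -> P i ->
  dyson_drift z i \is a fin_num ->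
  (forall j : 'I_n.+1, P j -> j != i -> fine (z j) != fine (z i)) /\
  fine (dyson_drift z i) =
    n.+1%:R^-1 * force n.+1 P (fun k => fine (z (inord k))) i.
Proof.
move=> zP Pi; rewrite /dyson_drift => fd.
have fr (j : 'I_n.+1) : j != i -> repulsion (z i) (z j) \is a fin_num.
  suff /sum_fin_numP H : (\sum_(j < n.+1 | j != i) repulsion (z i) (z j))%E \is a fin_num.
    by move=> ji; apply: H; rewrite ?mem_index_enum.
  have n0 : (0 < n.+1%:R^-1 :> R) by rewrite invr_gt0.
  move: fd; case: (\sum_(j < _ | _) _)%E => //.
    by rewrite gt0_muley// lte_fin.
  by rewrite gt0_muleNy// lte_fin.
have rE (j : 'I_n.+1) : P j -> j != i ->
    fine (z i) != fine (z j) /\ repulsion (z i) (z j) = (fine (z i) - fine (z j))^-1%:E.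
  by move=> Pj ji; apply: repulsion_fin_num; rewrite ?zP//; exact: fr.
split=> [j Pj ji|]; first by rewrite eq_sym; exact: (rE j Pj ji).1.
rewrite /force (bigID (fun j : 'I_n.+1 => P j))/= addeC big1 ?add0e; last first.
  by move=> j /andP[_ Pj]; rewrite /repulsion zP Pi zP (negbTE Pj).
rewrite [in RHS](bigD1 i)//= inord_val subrr invr0 add0r.
under [in RHS]eq_bigr do rewrite inord_val.
under eq_bigl do rewrite andbC.
by under eq_bigr => j /andP[Pj ji] do rewrite (rE j Pj ji).2; rewrite sumEFin.
Qed.

Context {n : nat} {P : pred nat} {beta : R} {b : 'I_n.+1 -> R -> R}
  {x : 'I_n.+1 -> R -> \bar R}.
Hypothesis xP : forall (i : 'I_n.+1) (t : R), 0 <= t -> (x i t \is a fin_num) = P i.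
Hypothesis dx : dyson_path beta b x.

Lemma dyson_path_integral k t : (k < n.+1)%N -> P k -> 0 <= t ->
  mu.-integrable `[0, t] (EFin \o drift x k) /\
  position x k t = position x k 0 + \int[mu]_(s in `[0, t]) drift x k s +
    Num.sqrt (2 / (beta * n.+1%:R)) * b (inord k) t.
Proof.
move=> kn Pk t0; have [_ _ _ /(_ (inord k))] := dx.
rewrite (xP _ 0 (lexx _)) inordK// => /(_ Pk t t0)[fx ix E].
have mdr := measurable_int _ ix.
have ae_fin : {ae mu, forall s, `[0, t]%classic s ->
    dyson_drift (x ^~ s) (inord k) = (EFin \o drift x k) s}.
  have := integrable_ae _ ix; move=> /(_ (measurable_itv _)).
  by apply: filterS => s fs st; rewrite /drift /= fineK//; exact: fs.
have mu' : measurable_fun `[0, t] (EFin \o drift x k).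
  by apply/measurable_EFinP; apply: measurableT_comp.
have iE : (\int[mu]_(s in `[0%R, t]) dyson_drift (x ^~ s) (inord k) =
    \int[mu]_(s in `[0%R, t]) (drift x k s)%:E)%E by exact: ae_eq_integral.
have iu : mu.-integrable `[0, t] (EFin \o drift x k).
  have /integrableP[_ ifin] := ix.
  apply/integrableP; split => //; apply: le_lt_trans ifin.
  rewrite le_eqVlt; apply/orP; left; apply/eqP/esym/ae_eq_integral => //.
  - exact: measurableT_comp.
  - exact: measurableT_comp.
  - apply: filterS ae_fin; first exact: (ae_filter_ringOfSetsType mu).
    by move=> s E' /E' ->.
split => //.
rewrite {1}/position E iE -(@fineK _ (\int[mu]_(_ in _) _)%E); last first.
  exact: integrable_fin_num.
by rewrite -[x _ 0%R]fineK ?xP ?inordK.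
Qed.

(** Integrable drifts are finite almost everywhere, hence given by the forces. *)
Lemma dyson_path_ae t : 0 <= t -> {ae mu, forall s, `[0, t]%classic s ->
   (forall k, (k < n.+1)%N -> P k ->
      drift x k s = n.+1%:R^-1 * force n.+1 P (position x ^~ s) k) /\
   (forall j k, (j < k < n.+1)%N -> P j -> P k ->
      position x k s < position x j s)}.
Proof.
move=> t0.
have H : {ae mu, forall s, forall i : 'I_n.+1, `[0, t]%classic s -> P i ->
    dyson_drift (x ^~ s) i \is a fin_num}.
  apply: filter_forall => i; case: (boolP (P i)) => Pi; last exact: nearW.
  have [_ _ _ /(_ i)] := dx; rewrite (xP _ 0 (lexx _)) => /(_ Pi t t0)[_ ix _].
  have := integrable_ae _ ix; move=> /(_ (measurable_itv _)).
  by apply: filterS => s fs st _; exact: fs.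
apply: filterS H; first exact: (ae_filter_ringOfSetsType mu).
move=> s fs st; have s0 : 0 <= s by move: st; rewrite /= in_itv/= => /andP[].
have key i (Pi : P (val i)) :=
  dyson_drift_fin_num n P (x ^~ s) i (fun j => xP j s s0) Pi (fs i st Pi).
split=> [k kn Pk|j k /andP[jk kn] Pj Pk].
  have Pk' : P (val (@inord n k)) by rewrite /= inordK.
  by have [_] := key _ Pk'; rewrite /= inordK.
have jn := ltn_trans jk kn.
have Pk' : P (val (@inord n k)) by rewrite /= inordK.
have Pj' : P (val (@inord n j)) by rewrite /= inordK.
have [/(_ (inord k) Pk') ne _] := key _ Pj'.
have [ord _ _ _] := dx.
rewrite lt_neqAle ne; last by rewrite -val_eqE/= !inordK// gtn_eqF.
rewrite -lee_fin /position !fineK ?xP//.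
by apply: ord => //; rewrite !inordK// ltnW.
Qed.

End dyson_paths.

(** * Comparison of two paths with the same noise *)

Section comparison.
Context {R : realType}.
Notation mu := (@lebesgue_measure R).
Context {n l m : nat} {beta : R} {b : 'I_n.+1 -> R -> R}
  {x y : 'I_n.+1 -> R -> \bar R}.
Hypotheses (dx : dyson_path beta b x) (dy : dyson_path beta b y).
Hypotheses (lm : (l < m)%N) (mn : (m <= n.+1)%N).

(** The two paths share the noise term, which cancels. *)
Lemma difference_integral (P Q : pred nat) k t :
  (forall (i : 'I_n.+1) (t : R), 0 <= t -> (x i t \is a fin_num) = P i) ->
  (forall (i : 'I_n.+1) (t : R), 0 <= t -> (y i t \is a fin_num) = Q i) ->
  (k < n.+1)%N -> P k -> Q k -> 0 <= t ->
  mu.-integrable `[0, t] (EFin \o (fun s => drift x k s - drift y k s)) /\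
  position x k t - position y k t = position x k 0 - position y k 0 +
    \int[mu]_(s in `[0, t]) (drift x k s - drift y k s).
Proof.
move=> xP yQ kn Pk Qk t0.
have [iu Ex] := dyson_path_integral xP dx k t kn Pk t0.
have [iv Ey] := dyson_path_integral yQ dy k t kn Qk t0.
split; first exact: integrable_subr.
by rewrite RintegralB// Ex Ey; ring.
Qed.

Lemma dyson_path_order_preserved :
  (forall (i : 'I_n.+1) (t : R), 0 <= t -> (x i t \is a fin_num) = (l <= i)%N) ->
  (forall (i : 'I_n.+1) (t : R), 0 <= t -> (y i t \is a fin_num) = (i < m)%N) ->
  (forall i : 'I_n.+1, (l <= i < m)%N -> (y i 0 <= x i 0)%E) ->
  forall (i : 'I_n.+1) t, (l <= i < m)%N -> 0 <= t -> (y i t <= x i t)%E.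
Proof.
move=> xP yQ xy0 i t ilm t0.
have H0 := difference_integral (leq l) (gtn m) _ _ xP yQ.
suff : 0 <= position x i t - position y i t.
  move: (ilm) => /andP[li im].
  by rewrite subr_ge0 -lee_fin /position inord_val !fineK ?xP ?yQ.
apply: (nonneg_preserved 'I_n.+1 (fun i => (l <= i < m)%N)
  (fun i t => position x i t - position y i t)
  (fun i s => drift x i s - drift y i s)) => //.
- move=> j jlm; have /andP[lj jm] := jlm.
  by rewrite subr_ge0 -lee_fin /position inord_val !fineK ?xP ?yQ ?xy0.
- by move=> j r /andP[lj jm] r0; exact: (H0 _ _ (ltn_ord j) lj jm r0).1.
- by move=> j r /andP[lj jm] r0; exact: (H0 _ _ (ltn_ord j) lj jm r0).2.
move=> r r0.
have ax := dyson_path_ae (P := leq l) xP dx r r0.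
have ay := dyson_path_ae (P := gtn m) yQ dy r r0.
apply: filterS2 ax ay; first exact: (ae_filter_ringOfSetsType mu).
move=> s + + sr => /(_ sr)[uE xlt] /(_ sr)[vE ylt].
rewrite (_ : \sum_(_ < _ | _) _ = n.+1%:R^-1 *
  \sum_(j < n.+1 | (l <= j < m)%N && (position x j s - position y j s < 0))
    (force n.+1 (leq l) (position x ^~ s) j - force n.+1 (gtn m) (position y ^~ s) j)).
  rewrite mulr_ge0//; apply: force_deficit_ge0 => //.
  - by move=> j k lj /andP[jk kn]; apply: xlt; rewrite ?jk//= (leq_trans lj) ?(ltnW jk).
  - move=> j k /andP[jk km]; apply: ylt; rewrite ?jk ?(leq_trans km)//=.
    by rewrite (ltn_trans jk).
rewrite mulr_sumr; apply: eq_bigr => j /andP[/andP[lj jm] _].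
by rewrite mulrBr -uE// -vE.
Qed.

Lemma dyson_path_gaps_preserved :
  (forall (i : 'I_n.+1) (t : R), 0 <= t -> (x i t \is a fin_num) = (l <= i < m)%N) ->
  (forall (i : 'I_n.+1) (t : R), 0 <= t -> y i t \is a fin_num) ->
  (forall i j : 'I_n.+1, (l <= i)%N -> (i < j)%N -> (j < m)%N ->
     (y i 0 - y j 0 <= x i 0 - x j 0)%E) ->
  forall (i j : 'I_n.+1) t, (l <= i)%N -> (i < j)%N -> (j < m)%N -> 0 <= t ->
     (y i t - y j t <= x i t - x j t)%E.
Proof.
move=> xP yQ xy0 i j t li ij jm t0.
have H0 := difference_integral (within l m) predT _ _ xP yQ.
(* It suffices to treat neighbouring particles. *)
pose D k t := position x k t - position y k t - (position x k.+1 t - position y k.+1 t).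
pose G (k : 'I_n.+1) := (l <= k)%N && (k.+1 < m)%N.
have E (p q : 'I_n.+1) r : (l <= p < m)%N -> (l <= q < m)%N -> 0 <= r ->
    (y p r - y q r <= x p r - x q r)%E =
    (position x q r - position y q r <= position x p r - position y p r).
  move=> plm qlm r0; rewrite -[y p r]fineK ?yQ// -[y q r]fineK ?yQ//.
  rewrite -[x p r]fineK ?xP// -[x q r]fineK ?xP//.
  rewrite -!EFinB lee_fin /position !inord_val.
  by apply/idP/idP; lra.
have D0 k r : (l <= k)%N -> (k.+1 < m)%N -> 0 <= r -> 0 <= D k r.
  move=> lk km r0.
  have kn : (k < n.+1)%N by rewrite (leq_trans (ltnW km)).
  apply: (nonneg_preserved 'I_n.+1 G (fun k => D k)
    (fun k s => (drift x k s - drift y k s) - (drift x k.+1 s - drift y k.+1 s))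
    _ _ _ _ (Ordinal kn) r) => //; last by rewrite /G lk.
  - move=> p /andP[lp pm]; rewrite subr_ge0.
    have pn : (p.+1 < n.+1)%N by rewrite (leq_trans pm).
    have := xy0 p (inord p.+1); rewrite inordK// E// ?lp ?(ltnW pm) ?inordK//.
      by rewrite ltnSn => /(_ isT isT pm).
    by rewrite (leqW lp).
  - move=> p s /andP[lp pm] s0.
    have Sp : (l <= p < m)%N by rewrite lp (ltnW pm).
    have Sp1 : (l <= p.+1 < m)%N by rewrite (leqW lp).
    apply: integrable_subr; first exact: (H0 p s (ltn_ord p) Sp isT s0).1.
    exact: (H0 p.+1 s (leq_trans pm mn) Sp1 isT s0).1.
  - move=> p s /andP[lp pm] s0.
    have Sp : (l <= p < m)%N by rewrite lp (ltnW pm).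
    have Sp1 : (l <= p.+1 < m)%N by rewrite (leqW lp).
    have [i1 E1] := H0 p s (ltn_ord p) Sp isT s0.
    have [i2 E2] := H0 p.+1 s (leq_trans pm mn) Sp1 isT s0.
    by rewrite /D E1 E2 [in RHS]RintegralB//; ring.
  move=> s s0.
  have ax := dyson_path_ae (P := within l m) xP dx s s0.
  have ay := dyson_path_ae (P := predT) yQ dy s s0.
  apply: filterS2 ax ay; first exact: (ae_filter_ringOfSetsType mu).
  move=> q + + sq => /(_ sq)[uE xlt] /(_ sq)[vE ylt].
  have := gapforce_deficit_ge0 n.+1 l m (position x ^~ q) (position y ^~ q).
  rewrite lm mn => H.
  rewrite (_ : \sum_(_ < _ | _) _ = n.+1%:R^-1 *
    \sum_(p < n.+1 | G p && (D p q < 0))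
      (gapforce n.+1 l m (position x ^~ q) p -
       (force n.+1 predT (position y ^~ q) p - force n.+1 predT (position y ^~ q) p.+1))).
    rewrite mulr_ge0//; apply: H => //.
      move=> p lp pm; apply: xlt; rewrite /within ?ltnSn ?lp ?(leqW lp) ?(ltnW pm)//.
      by rewrite (leq_trans pm).
    by move=> p p' pp'; exact: ylt.
  rewrite mulr_sumr; apply: eq_bigr => p /andP[/andP[lp pm] _].
  have Sp : (l <= p < m)%N by rewrite lp (ltnW pm).
  have Sp1 : (l <= p.+1 < m)%N by rewrite (leqW lp).
  have pn := leq_trans pm mn.
  rewrite /gapforce (uE p (ltn_ord p) Sp) (uE p.+1 pn Sp1).
  rewrite (vE p (ltn_ord p) isT) (vE p.+1 pn isT); ring.
rewrite E// ?li ?jm ?(ltn_trans ij jm) ?(leq_trans li (ltnW ij))//.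
apply: (nonincreasing_on_range l m (fun k => position x k t - position y k t)) => //.
  by move=> k lk km; rewrite -subr_ge0; exact: D0.
exact: ltnW.
Qed.
End comparison.

Theorem lemma2p10 (R : realType) (d : measure_display) (T : measurableType d)
    (P : probability T R) (F : R -> set (set T)) (beta : R) (l m n : nat)
    (B : 'I_n -> R -> T -> R) (lambda lambda' : 'I_n -> R -> T -> \bar R)
    (beta_ge1 : 1 <= beta)
    (l_ge1 : (1 <= l)%N) (le_lm : (l <= m)%N) (le_mn : (m <= n)%N)
    (F_filtration : is_filtration F)
    (B_brownian : is_brownian_family P F B)
    (lambda_dyson : is_dyson_bm P F beta B lambda)
    (lambda'_dyson : is_dyson_bm P F beta B lambda') :
  (finite_exactly_on P lambda l n ->
   finite_exactly_on P lambda' 1 m ->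
   {ae P, forall w, forall i : 'I_n, (l <= i.+1 <= m)%N ->
      (lambda i 0%R w >= lambda' i 0%R w)%E} ->
   {ae P, forall w, forall (i : 'I_n) (t : R), (l <= i.+1 <= m)%N -> 0 <= t ->
      (lambda i t w >= lambda' i t w)%E})
  /\
  (finite_exactly_on P lambda l m ->
   finite_exactly_on P lambda' 1 n ->
   {ae P, forall w, forall i j : 'I_n,
      (l <= i.+1)%N -> (i.+1 < j.+1)%N -> (j.+1 <= m)%N ->
      (lambda i 0%R w - lambda j 0%R w
       >= lambda' i 0%R w - lambda' j 0%R w)%E} ->
   {ae P, forall w, forall (i j : 'I_n) (t : R),
      (l <= i.+1)%N -> (i.+1 < j.+1)%N -> (j.+1 <= m)%N -> 0 <= t ->
      (lambda i t w - lambda j t w >= lambda' i t w - lambda' j t w)%E}).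
Proof.
(* Ordinals count from 0: after the shift, the particles from l on are those of
   ordinal at least l. *)
case: l l_ge1 le_lm => // l _ lm.
case: n le_mn B lambda lambda' B_brownian lambda_dyson lambda'_dyson =>
  [|n] mn B x y _ [_ dx] [_ dy].
  by move: (leq_trans lm mn).
have fin_numE (z : 'I_n.+1 -> R -> T -> \bar R) a c w :
    (forall (i : 'I_n.+1) (t : R), 0 <= t ->
     [/\ (i.+1 < a)%N -> z i t w = +oo%E,
         (a <= i.+1 <= c)%N -> z i t w \is a fin_num &
         (c < i.+1)%N -> z i t w = -oo%E]) ->
    forall (i : 'I_n.+1) (t : R), 0 <= t -> (z i t w \is a fin_num) = (a <= i.+1 <= c)%N.
  move=> H i t t0; have [Hlow Hmid Hhigh] := H i t t0.
  have [ai|ia] /= := leqP a i.+1; last by rewrite Hlow.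
  have [ic|ci] := leqP i.+1 c; last by rewrite Hhigh.
  by apply: Hmid; rewrite ai.
split=> fx fy xy0.
  apply: filterS3 (filterI fx fy) (filterI dx dy) xy0 => w [{}fx {}fy] [{}dx {}dy] xy0.
  apply: (dyson_path_order_preserved dx dy mn) => // i t t0.
  - by rewrite (fin_numE x _ _ _ fx)// ltn_ord andbT.
  - by rewrite (fin_numE y _ _ _ fy).
apply: filterS3 (filterI fx fy) (filterI dx dy) xy0 => w [{}fx {}fy] [{}dx {}dy] xy0.
apply: (dyson_path_gaps_preserved dx dy lm mn) => // i t t0.
- by rewrite (fin_numE x _ _ _ fx).
- by rewrite (fin_numE y _ _ _ fy)//= ltn_ord.
Qed.
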